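(* (i) Given an affine resolvable $(v,k,\lambda)$ design with $r$ parallel classes, an $FPA_k(v,v-k)$ may be constructed of size $r$. (ii) If there exist $m$ mutually orthogonal latin squares (MOLS) of order $n$, then an $FPA_n(n^2, n^2-n)$ may be constructed of size $m+2$. In particular, if $q$ is a prime power, an $FPA_q(q^2,q^2-q)$ may be constructed of size $q+1$.
   Context: Frequency permutation arrays: let $N=Mf$ with $N,M,f$ positive integers. An $f$-permutation of length $N$ is an arrangement (sequence of length $N$) of the multiset consisting of $M$ distinct symbols, each repeated exactly $f$ times. The distance between two distinct $f$-permutations is the Hamming distance, i.e. the number of positions in which they disagree. A frequency permutation array of length $N$, frequency $f$ and minimum distance $d$, denoted $FPA_f(N,d)$, is a set $T$ of $f$-permutations of length $N$ (on the same $M$ symbols) such that the distance between any two members of $T$ is at least $d$; equivalently, it is an array whose rows consist of $M$ distinct symbols, each repeated exactly $f$ times, such that the distance between any two rows is at least $d$. Its size is the number of members (rows). Designs: a balanced incomplete block design with parameters $(v,k,\lambda)$ consists of a finite set $V$ of $v$ points, and a collection $B$ of equally sized subsets of $V$ called blocks, each of size $k$, such that every pair of distinct points of $V$ occurs in exactly $\lambda$ blocks. A resolvable design has the additional property that the collection $B$ of blocks can be partitioned into parallel classes, such that every point of $V$ occurs exactly once in each parallel class. An affine resolvable design is a resolvable design with the further property that any two non-parallel blocks intersect in precisely $\mu$ points, where $\mu=\frac{k^2}{v}$ is a positive integer. Latin squares: a latin square of order $n$ is an $n\times n$ array in which $n$ distinct symbols are arranged so that each symbol occurs once in each row and column. Two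 latin squares of the same order $n$ are orthogonal if, when superimposed, each of the possible $n^2$ ordered pairs occurs exactly once. A set $\{L_1,\ldots,L_t\}$ of $t\geq 2$ latin squares is mutually orthogonal (a set of MOLS) if the squares in the set are pairwise orthogonal. *)

(* Defs.v *)
From mathcomp Require Import all_boot all_order all_algebra.

Set Implicit Arguments.
Unset Strict Implicit.
Unset Printing Implicit Defensive.

Definition hamming (N : nat) (S : eqType) (s t : N.-tuple S) : nat :=
  #|[set i : 'I_N | tnth s i != tnth t i]|.

Definition is_fperm (f N M : nat) (s : N.-tuple 'I_M) : Prop :=
  forall a : 'I_M, count_mem a s = f.

Definition is_FPA (f N d M : nat) (T : {set N.-tuple 'I_M}) : Prop :=
  [/\ [/\ 0 < N, 0 < M, 0 < f & N = M * f],
      forall s, s \in T -> is_fperm f s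
    & forall s t, s \in T -> t \in T -> s != t -> d <= hamming s t].

Definition has_FPA (f N d size : nat) : Prop :=
  exists (M : nat) (T : {set N.-tuple 'I_M}), is_FPA f d T /\ #|T| = size.

(* A design has at least one block: the empty family would satisfy the other
   clauses vacuously when lambda = 0 or v = 1. *)
Definition bibd (v k lambda : nat) (V : finType) (B : {set {set V}}) : Prop :=
  [/\ #|V| = v,
      B != set0,
      forall b, b \in B -> #|b| = k
    & forall x y : V, x != y ->
        #|[set b in B | (x \in b) && (y \in b)]| = lambda].

Definition is_resolution (V : finType) (B : {set {set V}})
    (P : {set {set {set V}}}) : Prop :=
  partition P B /\
  forall C, C \in P -> forall x : V, #|[set b in C | x \in b]| = 1.

Definition parallel (V : finType) (P : {set {set {set V}}})
    (b1 b2 : {set V}) : bool :=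
  [exists C in P, (b1 \in C) && (b2 \in C)].

(* Since k ^ 2 %/ 0 = 0, positivity of the quotient also forces 0 < v. *)
Definition affine_resolvable (v k lambda : nat) (V : finType)
    (B : {set {set V}}) (P : {set {set {set V}}}) : Prop :=
  [/\ bibd v k lambda B,
      is_resolution B P,
      v %| k ^ 2,
      0 < k ^ 2 %/ v
    & forall b1 b2, b1 \in B -> b2 \in B -> ~~ parallel P b1 b2 ->
        #|b1 :&: b2| = k ^ 2 %/ v].

Definition latin_square (n : nat) (L : 'M['I_n]_n) : Prop :=
  (forall i a, #|[set j | L i j == a]| = 1) /\
  (forall j a, #|[set i | L i j == a]| = 1).

Definition orthogonal_squares (n : nat) (L1 L2 : 'M['I_n]_n) : Prop :=
  forall a b : 'I_n,
    #|[set p : 'I_n * 'I_n | (L1 p.1 p.2 == a) && (L2 p.1 p.2 == b)]| = 1.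

(* The squares form a set, hence are distinct; with at least two of them this
   excludes the degenerate orders n = 0 and n = 1. *)
Definition is_MOLS (n : nat) (S : {set 'M['I_n]_n}) : Prop :=
  [/\ 2 <= #|S|,
      forall L, L \in S -> latin_square L
    & forall L1 L2, L1 \in S -> L2 \in S -> L1 != L2 ->
        orthogonal_squares L1 L2].

Definition prime_power (q : nat) : Prop :=
  exists p e : nat, [/\ prime p, 0 < e & q = p ^ e].

(* Main.v *)
(** If the colourings [c i] of [v] points have [M] classes of size [k], and
    equally coloured classes of two of them meet in [mu] points with
    [M * mu = k], then two of the colourings agree in exactly [k] points, so
    they form an FPA of distance [v - k].  Parallel classes of an affine
    resolvable design are such colourings; so are [m] MOLS of order [n] together
    with the row and column colourings of the [n * n] cells, and the [q + 1]
    directions of the affine plane over the field with [q] elements. *)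
Require Import Defs.
From mathcomp Require Import all_boot all_order all_algebra all_field.
From mathcomp Require Import ring.

Set Implicit Arguments.
Unset Strict Implicit.
Unset Printing Implicit Defensive.

Lemma card_enum_val_preim (X : finType) (P : pred X) :
  #|[set k : 'I_#|X| | P (enum_val k)]| = #|[set x | P x]|.
Proof.
rewrite -!sum1dep_card [RHS](reindex (@enum_val X predT)) //.
exact/onW_bij/enum_val_bij.
Qed.

Lemma count_mem_tnth (N : nat) (S : eqType) (s : N.-tuple S) (a : S) :
  count_mem a s = #|[set k | tnth s k == a]|.
Proof. by rewrite -sum1dep_card -sum1_count big_tuple. Qed.

(* With a single colour all the [c i] would yield the same word, hence the
   condition [1 < #|A|] as soon as [I] has two elements. *)
Lemma has_FPA_colorings (f mu : nat) (X A I : finType) (c : I -> X -> A) :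
    0 < f -> #|X| = #|A| * f -> #|A| * mu = f ->
    (forall (i : I) (a : A), #|[set x | c i x == a]| = f) ->
    (forall i j : I, i != j -> 1 < #|A|) ->
    (forall (i j : I) (a : A), i != j ->
      #|[set x | (c i x == a) && (c j x == a)]| = mu) ->
  has_FPA f #|X| (#|X| - f) #|I|.
Proof.
move=> f_gt0 cardX def_f class_size A_gt1 meet_size.
have A_gt0 : 0 < #|A| by move: f_gt0; rewrite -def_f muln_gt0 => /andP[].
(* The word of a colouring lists the colours along the enumeration of [X]. *)
pose w i : #|X|.-tuple 'I_#|A| :=
  [tuple enum_rank (c i (enum_val k)) | k < #|X|].
have hamming_w i j : i != j -> hamming (w i) (w j) = #|X| - f.
  move=> neq_ij; rewrite /hamming.
  under eq_finset => k do rewrite !tnth_mktuple (inj_eq enum_rank_inj).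
  rewrite (card_enum_val_preim (fun x => c i x != c j x)).
  have -> : [set x | c i x != c j x] = ~: [set x | c i x == c j x].
    by apply/setP=> x; rewrite !inE.
  rewrite cardsCs setCK; congr (_ - _).
  (* Sorting the points of agreement by their common colour gives [#|A|] sets of size [mu]. *)
  rewrite -sum1dep_card (partition_big (c i) predT) //= -def_f.
  rewrite -sum_nat_const; apply: eq_bigr => a _.
  rewrite sum1dep_card -(meet_size i j a neq_ij); apply: eq_card => x.
  by rewrite !inE andbC; case: eqP => //= ->; rewrite eq_sym.
have w_inj : injective w.
  move=> i j eq_w; apply/eqP/negPn/negP => neq_ij.
  have := hamming_w i j neq_ij; rewrite eq_w /hamming.
  have -> : [set k | tnth (w j) k != tnth (w j) k] = set0.
    by apply/setP=> k; rewrite !inE eqxx.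
  (* Equal words are at distance 0, which would force [#|A| * f <= f]. *)
  move/esym/eqP; rewrite cards0 subn_eq0 cardX leqNgt.
  by rewrite -[X in X < _]mul1n ltn_pmul2r // (A_gt1 i j).
exists #|A|, (w @: setT); split; last by rewrite card_imset // cardsT.
split.
- by rewrite cardX muln_gt0 A_gt0 f_gt0.
- move=> _ /imsetP[i _ ->] a.
  rewrite count_mem_tnth -(class_size i (enum_val a)).
  rewrite -(card_enum_val_preim (fun x => c i x == enum_val a)).
  apply: eq_card => k.
  by rewrite !inE tnth_mktuple -(inj_eq enum_val_inj) enum_rankK.
- move=> _ _ /imsetP[i _ ->] /imsetP[j _ ->]; rewrite (inj_eq w_inj) => neq_ij.
  by rewrite hamming_w.
Qed.

(** Colours are ordinals rather than blocks, so that parallel classes with equally many blocks share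
    one alphabet. *)
Lemma partition_coloring (V : finType) (C : {set {set V}}) :
  partition C [set: V] ->
  exists c : V -> 'I_#|C|,
    forall a, exists2 b, b \in C & [set x | c x == a] = b.
Proof.
case/and3P=> /eqP coverC tiC _.
have pblockC x : pblock C x \in C by rewrite pblock_mem // coverC inE.
exists (fun x => enum_rank_in (pblockC x) (pblock C x)) => a.
exists (enum_val a); first exact: enum_valP.
apply/setP=> x; rewrite inE -(inj_eq enum_val_inj) enum_rankK_in //.
apply/eqP/idP=> [<-|]; last exact: def_pblock (enum_valP a).
by rewrite mem_pblock coverC inE.
Qed.

Lemma partition_exact_cover (V : finType) (C : {set {set V}}) :
  set0 \notin C -> (forall x, #|[set b in C | x \in b]| = 1) ->
  partition C [set: V].
Proof.
move=> C0 cover1; apply/and3P; split=> //.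
  apply/eqP/setP=> x; rewrite inE; apply/bigcupP.
  have /card_gt0P[b] : 0 < #|[set b in C | x \in b]| by rewrite cover1.
  by rewrite inE => /andP[Cb bx]; exists b.
apply/trivIsetP=> b1 b2 Cb1 Cb2; apply: contraR => /pred0Pn[x /andP[b1x b2x]].
have /card_le1_eqP eq1 : #|[set b in C | x \in b]| <= 1 by rewrite cover1.
by apply/eqP/eq1; rewrite inE ?Cb1 ?Cb2.
Qed.

Lemma has_FPA_affine_resolvable (v k lambda : nat) (V : finType)
    (B : {set {set V}}) (P : {set {set {set V}}}) :
  affine_resolvable v k lambda B P -> has_FPA k v (v - k) #|P|.
Proof.
case=> -[cardV B_neq0 block_size _] [/and3P[/eqP coverP tiP P0] class_cover].
set mu := k ^ 2 %/ v => v_dvd mu_gt0 meet_size.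
have k_gt0 : 0 < k by move: mu_gt0; rewrite /mu; case: (k) => //; rewrite div0n.
have inB C b : C \in P -> b \in C -> b \in B.
  by move=> PC Cb; rewrite -coverP; apply/bigcupP; exists C.
have classP C : C \in P -> partition C [set: V].
  move=> PC; apply: partition_exact_cover (class_cover _ PC).
  apply/negP=> /(inB _ _ PC)/block_size; rewrite cards0 => k0.
  by rewrite -k0 in k_gt0.
have card_class C : C \in P -> v = #|C| * k.
  move=> PC; rewrite -cardV -cardsT.
  apply: card_uniform_partition (classP _ PC).
  by move=> b /(inB _ _ PC); apply: block_size.
(* Divisibility of [v] by [k] is read off from some parallel class, which exists because there is a
   block. *)
have [C0 PC0] : exists C, C \in P.
  have [b] := set0Pn _ B_neq0.
  by rewrite -coverP => /bigcupP[C PC _]; exists C.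
have def_v : v = v %/ k * k.
  by rewrite {2}(card_class _ PC0) mulnK // -card_class.
have not_parallel C D b1 b2 : C \in P -> D \in P -> C != D ->
    b1 \in C -> b2 \in D -> ~~ parallel P b1 b2.
  move=> PC PD neq_CD Cb1 Db2; apply/existsP=> -[E /and3P[PE Eb1 Eb2]].
  by rewrite -(def_pblock tiP PC Cb1) -(def_pblock tiP PD Db2)
             (def_pblock tiP PE Eb1) (def_pblock tiP PE Eb2) eqxx in neq_CD.
pose I : finType := {C | C \in P}.
have /fin_all_exists[c cP] (C : I) : exists c : V -> 'I_(v %/ k), forall a,
    exists2 b, b \in val C & [set x | c x == a] = b.
  have <- : #|val C| = v %/ k by rewrite (card_class _ (valP C)) mulnK.
  exact/partition_coloring/classP/valP.
have -> : #|P| = #|{: I}| by rewrite card_sig.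
have meet (C D : I) a :
    C != D -> #|[set x | (c C x == a) && (c D x == a)]| = mu.
  move=> neq_CD; have [b1 Cb1 def_b1] := cP C a; have [b2 Db2 def_b2] := cP D a.
  rewrite -(meet_size b1 b2 (inB _ _ (valP C) Cb1) (inB _ _ (valP D) Db2)).
    by rewrite -def_b1 -def_b2; apply: eq_card => x; rewrite !inE.
  exact: not_parallel (valP C) (valP D) neq_CD Cb1 Db2.
rewrite -cardV; apply: (has_FPA_colorings (mu := mu) (c := c)) => //.
- by rewrite card_ord cardV.
- apply/eqP; rewrite card_ord -(eqn_pmul2r k_gt0) mulnAC -def_v mulnC.
  by rewrite divnK ?mulnn.
- move=> C a; have [b Cb ->] := cP C a.
  by rewrite block_size // (inB _ _ (valP C)).
(* With at most one colour every block is all of [V], so two distinct parallel classes would share a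
   block. *)
- move=> C D neq_CD; rewrite card_ord ltnNge; apply/negP=> M_le1.
  have v_le_k : v <= k.
    by rewrite [X in X <= _]def_v -[X in _ <= X]mul1n leq_mul2r M_le1 orbT.
  have full E b : E \in P -> b \in E -> b = [set: V].
    move=> PE Eb; apply/eqP.
    by rewrite eqEcard subsetT cardsT cardV (block_size b) // (inB E).
  have nonempty E : E \in P -> exists b, b \in E.
    by move=> PE; apply/set0Pn/eqP=> E0; move: P0; rewrite -E0 PE.
  have [b1 Cb1] := nonempty _ (valP C); have [b2 Db2] := nonempty _ (valP D).
  have /negP[] := not_parallel _ _ _ _ (valP C) (valP D) neq_CD Cb1 Db2.
  apply/existsP; exists (val C); rewrite (valP C) Cb1.
  by rewrite (full _ _ (valP D) Db2) -(full _ _ (valP C) Cb1).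
Qed.

(** Orthogonality fixes all sizes: a second colouring, available since [1 < #|I|], cuts each colour
    class into [n] single points, so [X] consists of [n] classes of size [n]. Here [mu] is 1. *)
Lemma has_FPA_orthogonal (n : nat) (X A I : finType) (c : I -> X -> A) :
    #|A| = n -> 1 < n -> 1 < #|I| ->
    (forall (i j : I) (a b : A), i != j ->
      #|[set x | (c i x == a) && (c j x == b)]| = 1) ->
  has_FPA n (n ^ 2) (n ^ 2 - n) #|I|.
Proof.
move=> cardA n_gt1 I_gt1 orth.
have class_size i a : #|[set x | c i x == a]| = n.
  have [j neq_ij] : exists j, i != j.
    apply/existsP; rewrite -negb_forall; apply: contraL I_gt1 => /forallP eq_i.
    rewrite -leqNgt; apply/card_le1_eqP => j1 j2 _ _.
    by rewrite -(eqP (eq_i j1)) -(eqP (eq_i j2)).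
  rewrite -sum1dep_card (partition_big (c j) predT) //= -[RHS]cardA -sum1_card.
  by apply: eq_bigr => b _; rewrite sum1dep_card orth.
have cardX : #|X| = n ^ 2.
  have [i _] : exists i, i \in I by apply/card_gt0P/ltnW.
  rewrite -sum1_card (partition_big (c i) predT) //= -mulnn.
  rewrite -[X in X * _]cardA -sum_nat_const.
  by apply: eq_bigr => a _; rewrite sum1dep_card class_size.
rewrite -cardX; apply: (has_FPA_colorings (mu := 1) (c := c)) => //.
- exact: ltnW.
- by rewrite cardX cardA mulnn.
- by rewrite muln1.
- by rewrite cardA.
- by move=> i j a; apply: orth.
Qed.

Lemma has_FPA_MOLS (n m : nat) (S : {set 'M['I_n]_n}) :
  is_MOLS S -> #|S| = m -> has_FPA n (n ^ 2) (n ^ 2 - n) (m + 2).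
Proof.
case=> S_gt1 latin orth <-.
(* In orders 0 and 1 there is only one matrix, hence no two distinct squares. *)
have n_gt1 : 1 < n.
  case: n S S_gt1 {latin orth} => [|[|//]] S /card_gt1P[L1 [L2 [_ _ /eqP[]]]].
    by apply/matrixP=> [[]].
  by apply/matrixP=> i j; rewrite !ord1.
pose T : finType := {L | L \in S}.
(* Besides the squares, [true] colours a cell by its row and [false] by its column. *)
pose c (t : T + bool) (p : 'I_n * 'I_n) : 'I_n :=
  match t with inl L => val L p.1 p.2 | inr b => if b then p.1 else p.2 end.
have -> : #|S| + 2 = #|{: T + bool}| by rewrite card_sum card_bool card_sig.
apply: (has_FPA_orthogonal (c := c)) => //.
- exact: card_ord.
- by rewrite card_sum card_bool addn2.
have row_latin (L : T) a b : #|[set p | (c (inl L) p == a) && (p.1 == b)]| = 1.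
  have [+ _] := latin _ (valP L) => /(_ b a)/eqP/cards1P[j def_j].
  apply/eqP/cards1P; exists (b, j); apply/setP => -[x y].
  have /setP/(_ y) := def_j; rewrite !inE /= => def_y.
  rewrite xpair_eqE andbC.
  by case: eqP => //= ->; rewrite def_y.
have col_latin (L : T) a b : #|[set p | (c (inl L) p == a) && (p.2 == b)]| = 1.
  have [_ +] := latin _ (valP L) => /(_ b a)/eqP/cards1P[i def_i].
  apply/eqP/cards1P; exists (i, b); apply/setP => -[x y].
  have /setP/(_ x) := def_i; rewrite !inE /= => def_x.
  rewrite xpair_eqE andbC [in RHS]andbC.
  by case: eqP => //= ->; rewrite def_x.
have swap (t u : T + bool) a b :
    #|[set p | (c t p == a) && (c u p == b)]|
      = #|[set p | (c u p == b) && (c t p == a)]|.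
  by apply: eq_card => p; rewrite !inE andbC.
have row_col a b :
    #|[set p | (c (inr true) p == a) && (c (inr false) p == b)]| = 1.
  apply/eqP/cards1P; exists (a, b); apply/setP => -[x y].
  by rewrite !inE xpair_eqE.
move=> [L1|[]] [L2|[]] a b // neq_tu; try by rewrite swap.
by apply: orth; rewrite ?(valP L1) ?(valP L2).
Qed.

Section AffinePlane.

Import GRing.Theory.
Local Open Scope ring_scope.

(* The parallel classes of lines of the affine plane over [F], indexed by
   their slope, [None] standing for the vertical lines. *)
Definition line_class {F : finFieldType} (s : option F) (p : F * F) : F :=
  if s is Some m then p.2 - m * p.1 else p.1.

Lemma line_class_orthogonal (F : finFieldType) (s t : option F) (a b : F) :
  s != t -> #|[set p | (line_class s p == a) && (line_class t p == b)]| = 1%N.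
Proof.
move=> neq_st; apply/eqP/cards1P.
case: s t neq_st => [m|] [m'|] // neq_st.
- have nz : m' - m != 0 by rewrite subr_eq0 eq_sym.
  (* Subtracting the equations [y - m * x = a] and [y - m' * x = b] of the two lines leaves
     [(m' - m) * x = a - b]. *)
  pose x := (a - b) / (m' - m).
  exists (x, a + m * x); apply/setP => -[y z]; rewrite !inE /= xpair_eqE /x.
  apply/andP/andP => {x} [[/eqP <- /eqP <-]|[/eqP -> /eqP ->]].
    by split; apply/eqP; field.
  by split; apply/eqP; field.
- exists (b, a + m * b); apply/setP => -[y z]; rewrite !inE /= xpair_eqE andbC.
  by case: eqP => //= ->; rewrite subr_eq.
- exists (a, b + m' * a); apply/setP => -[y z]; rewrite !inE /= xpair_eqE.
  by case: eqP => //= ->; rewrite subr_eq.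
Qed.

End AffinePlane.

(** The plane is used directly, not through MOLS, so that [q = 2] is covered: no two latin squares
    of order 2 are orthogonal. *)
Lemma has_FPA_prime_power (q : nat) :
  prime_power q -> has_FPA q (q ^ 2) (q ^ 2 - q) (q + 1).
Proof.
case=> p [e [p_pr e_gt0 def_q]].
have [F _ cardF] := PrimePowerField p_pr e_gt0.
have q_gt1 : 1 < q by rewrite def_q -(exp1n e) ltn_exp2r ?prime_gt1.
have card_slopes : q + 1 = #|{: option F}|.
  by rewrite card_option cardF -def_q addn1.
rewrite card_slopes.
apply: (has_FPA_orthogonal (c := line_class)) => //.
- by rewrite cardF def_q.
- by rewrite -card_slopes addn1 ltnW.
- exact: line_class_orthogonal.
Qed.

Theorem theorem3p6 :
  (forall (v k lambda r : nat) (V : finType) (B : {set {set V}})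
          (P : {set {set {set V}}}),
     affine_resolvable v k lambda B P -> #|P| = r ->
     has_FPA k v (v - k) r) /\
  (forall (n m : nat) (S : {set 'M['I_n]_n}),
     is_MOLS S -> #|S| = m ->
     has_FPA n (n ^ 2) (n ^ 2 - n) (m + 2)) /\
  (forall q : nat, prime_power q ->
     has_FPA q (q ^ 2) (q ^ 2 - q) (q + 1)).
Proof.
split=> [v k lambda r V B P affBP <-|].
  exact: has_FPA_affine_resolvable affBP.
by split=> [n m S|q]; [apply: has_FPA_MOLS | apply: has_FPA_prime_power].
Qed.
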